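(* Let $a,b\in\mathbb{N}$ and let $n$ be a strong alpha number of order $(a,b)$ with $\omega(n)\le 2$. Then $n$ is not a perfect square.
   Context: For a positive integer $n$ and $x\in\mathbb{N}$, $\sigma_x(n)=\sum_{d\mid n} d^x$; $\omega(n)$ is the number of distinct prime divisors of $n$. A positive integer $n$ is a strong alpha number of order $(a,b)$ if there exist coprime positive integers $\alpha_1,\alpha_2$ with $\sigma_a(n)=\frac{\alpha_1}{\alpha_2}n^{b}$ and $2\le \max(\alpha_1,\alpha_2)\le \omega(n)$. *)

(* Defs.v *)
From mathcomp Require Import all_boot all_order all_algebra.
Import GRing.Theory.

Set Implicit Arguments.
Unset Strict Implicit.
Unset Printing Implicit Defensive.

Definition sigma (x n : nat) : nat := \sum_(d <- divisors n) d ^ x.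

Definition omega (n : nat) : nat := size (primes n).

Definition strong_alpha (a b n : nat) : Prop :=
  0 < n /\
  exists alpha1 alpha2 : nat,
    [/\ 0 < alpha1, 0 < alpha2, coprime alpha1 alpha2,
        ((sigma a n)%:R = (alpha1%:R / alpha2%:R) * n%:R ^+ b :> rat)%R
      & 2 <= maxn alpha1 alpha2 <= omega n].

Definition perfect_square (n : nat) : Prop := exists m : nat, n = m ^ 2.

(* Main.v *)
(** The divisor sum [sigma a (m ^ 2)] is always odd: modulo 2 it counts the
    divisors of [m ^ 2] if [a = 0] and those of the odd part of [m ^ 2] if
    [a > 0], and a nonzero square has an odd number of divisors because
    [d |-> m ^ 2 / d] fixes only [m]. As [omega n <= 2] forces the pair
    [(alpha1, alpha2)] to be [(2, 1)] or [(1, 2)], either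
    [sigma a n = 2 * n ^ b] or [2 * sigma a n = n ^ b]. The first is even; in
    the second [n] is even, so [4] divides the square [n], hence [n ^ b], and
    [sigma a n] is even again. *)
Require Import Defs.
From mathcomp Require Import all_boot all_order all_algebra.
Import GRing.Theory Num.Theory.

Lemma perm_divisors_divn n :
  0 < n -> perm_eq [seq n %/ d | d <- divisors n] (divisors n).
Proof.
move=> n_gt0.
have divnK2 d : d \in divisors n -> n %/ (n %/ d) = d.
  rewrite -dvdn_divisors // => d_n.
  by rewrite divnA // mulKn.
apply: uniq_perm; [|exact: divisors_uniq|].
  rewrite map_inj_in_uniq ?divisors_uniq // => x y x_n y_n eq_xy.
  by rewrite -(divnK2 x) // eq_xy divnK2.
move=> d; apply/mapP/idP => [[e e_n ->]|d_n].
  by move: e_n; rewrite -!dvdn_divisors //; apply: dvdn_div.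
exists (n %/ d); last by rewrite divnK2.
by move: d_n; rewrite -!dvdn_divisors //; apply: dvdn_div.
Qed.

Lemma odd_size_divisors_sqr m : 0 < m -> odd (size (divisors (m ^ 2))).
Proof.
move=> m_gt0; have n_gt0 : 0 < m ^ 2 by rewrite expn_gt0 m_gt0.
set s := divisors (m ^ 2).
(* The involution [d |-> m ^ 2 %/ d] exchanges the divisors below [m] with those above it. *)
have ltgt : count (fun d => d < m) s = count (fun d => m < d) s.
  have /permP <- := perm_divisors_divn _ n_gt0; rewrite count_map.
  apply: eq_in_count => d; rewrite -dvdn_divisors // => d_n /=.
  by rewrite ltn_divLR ?(dvdn_gt0 n_gt0 d_n) // -mulnn ltn_pmul2l.
have count_m : count (pred1 m) s = 1.
  rewrite count_uniq_mem ?divisors_uniq // -dvdn_divisors //.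
  by rewrite -mulnn dvdn_mulr.
have disj : count (predI (pred1 m) (fun d => m < d)) s = 0.
  by rewrite -(count_pred0 s); apply: eq_count => d /=; case: ltngtP.
have count_ge :
    count (predC (fun d => d < m)) s = (count (fun d => m < d) s).+1.
  rewrite -add1n -[X in X + _]count_m -count_predUI disj addn0.
  by apply: eq_count => d /=; rewrite -leqNgt leq_eqVlt eq_sym.
rewrite -(count_predC (fun d => d < m)) ltgt.
by rewrite count_ge addnS addnn /= odd_double.
Qed.

(** An odd divisor is its own [2^']-part, and taking this part preserves divisibility. *)
Lemma perm_odd_divisors n :
  0 < n -> perm_eq [seq d <- divisors n | odd d] (divisors n`_2^').
Proof.
move=> n_gt0; apply: uniq_perm; rewrite ?filter_uniq ?divisors_uniq // => d.
rewrite mem_filter -!dvdn_divisors ?part_gt0 // odd_2'nat.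
apply/andP/idP => [[d_odd d_n]|d_n].
  by rewrite -(part_pnat_id d_odd) partn_dvd.
by rewrite (pnat_dvd d_n) ?part_pnat // (dvdn_trans d_n) ?dvdn_part.
Qed.

Lemma odd_sum_count (I : Type) (s : seq I) (F : I -> nat) :
  odd (\sum_(i <- s) F i) = odd (count (fun i => odd (F i)) s).
Proof.
by elim: s => [|i s IH]; rewrite ?big_nil // big_cons /= !oddD oddb IH.
Qed.

Lemma odd_sigma_sqr a m : 0 < m -> odd (sigma a (m ^ 2)).
Proof.
move=> m_gt0; rewrite /sigma odd_sum_count.
case: a => [|a].
  by rewrite (eq_count (a2 := predT)) // count_predT odd_size_divisors_sqr.
rewrite (eq_count (a2 := odd)) => [|d]; last by rewrite oddX.
have n_gt0 : 0 < m ^ 2 by rewrite expn_gt0 m_gt0.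
(* The odd part of [m ^ 2] is the square of the odd part of [m], so the count for squares applies
   again. *)
rewrite -size_filter (perm_size (perm_odd_divisors _ n_gt0)) partnX.
by rewrite odd_size_divisors_sqr ?part_gt0.
Qed.

(** The right side is 2 modulo 4, while a power of a square is odd or divisible by 4. *)
Lemma sqr_exp_neq_double_odd m b k : odd k -> (m ^ 2) ^ b <> 2 * k.
Proof.
move=> k_odd eq_mk; have: ~~ odd ((m ^ 2) ^ b) by rewrite eq_mk oddM.
case: b eq_mk => [|b] eq_mk; first by rewrite expn0.
rewrite -expnM oddX mul2n double_eq0 /= => m_even.
have : 2 * 2 %| 2 * k.
  rewrite -eq_mk expnS dvdn_mulr // -[2 * 2]/(2 ^ 2).
  by rewrite dvdn_exp2r // dvdn2.
by rewrite dvdn_pmul2l // dvdn2 k_odd.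
Qed.

Theorem theorem3p9 (a b n : nat) (hn : strong_alpha a b n)
  (hw : omega n <= 2) : ~ perfect_square n.
Proof.
case: hn => n_gt0 [x [y [x_gt0 y_gt0 co_xy eq_sigma /andP[max_ge2 max_le]]]].
case=> m def_n.
have m_gt0 : 0 < m by move: n_gt0; rewrite def_n expn_gt0 orbF.
have sigma_odd : odd (sigma a n) by rewrite def_n odd_sigma_sqr.
have eq_nat : y * sigma a n = x * n ^ b.
  apply/eqP; rewrite -(eqr_nat rat) !natrM natrX eq_sigma mulrA.
  by rewrite [(_ * (_ / _))%R]mulrC divfK // pnatr_eq0 -lt0n.
have := leq_trans max_le hw; rewrite geq_max => /andP[x_le2 y_le2].
(* The bound [max_ge2] excludes [(1, 1)] and coprimality excludes [(2, 2)]; the pair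
   [(x, y) = (1, 2)] is treated first, then [(2, 1)]. *)
case: x x_gt0 x_le2 co_xy eq_nat max_ge2 {eq_sigma max_le} => [|[|[|]]] // _ _;
  case: y y_gt0 y_le2 => [|[|[|]]] // _ _ _ eq_nat _.
  apply: (@sqr_exp_neq_double_odd m b _ sigma_odd).
  by rewrite -def_n eq_nat mul1n.
by move: sigma_odd; rewrite -[sigma a n]mul1n eq_nat oddM.
Qed.
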